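(* For every integer $n\ge 2$, $$A095240(n)=2\cdot\prod_{j=1}^{n-1}2^{\,d_{n,j}}\cdot(d_{n,j})!\cdot(b_{n,j}-d_{n,j})!\ .$$
   Context: Places $1,\dots,n$ stand in a row; neighbouring places have distance $1$. At any time at which at least one place is occupied, the distance of an empty place $x$ is $\min|x-y|$ over all occupied places $y$. Persons arrive one after another and each occupies one empty place. A run is a maximal block of consecutive empty places; its length is the number of its places. Basic politeness rule: every person except the first occupies one of the empty places whose distance is maximal among all empty places at that time. Modified politeness rule: every person except the first occupies one of the empty places of maximal distance, and among these always one lying in a run of greatest length. $A095240(n)$ (for $n\ge2$) is the number of sequences $(x_1,\dots,x_n)$ (permutations of $\{1,\dots,n\}$, $x_t$ being the place taken by the $t$-th person) in which $n$ persons fill all $n$ places obeying the modified politeness rule, the first person taking the leftmost or the rightmost place ($x_1\in\{1,n\}$). For positive integers $p,k$, consider $p$ places filled by $p$ persons according to the basic politeness rule with the first person taking the leftmost place. $b_{p,k}$ is the number of persons (the first person is not counted) who, at the moment of choosing, occupy a place of distance exactly $k$. $d_{p,k}$ (also for $k=1$) is the number of different sets of two neighbouring places for which, at some time during the filling, both places are empty and both have distance exactly $k$. These numbers do not depend on the choices made during the filling. *)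

(* Defs.v *)
From mathcomp Require Import all_boot all_fingroup all_algebra.

Set Implicit Arguments.
Unset Strict Implicit.
Unset Printing Implicit Defensive.

(* Places 1, ..., n are the elements 0, ..., n - 1 of 'I_n.  A set [O] is the
   set of occupied places. *)

(* The neutral element n exceeds every distance between two places, so for
   nonempty [O] this is the minimum over [O]. *)
Definition distance (n : nat) (O : {set 'I_n}) (x : 'I_n) : nat :=
  \big[minn/n]_(y in O) `|x - y|%N.

Definition consecutive (n : nat) (R : {set 'I_n}) : bool :=
  [forall x in R, forall z in R, forall y : 'I_n, (x <= y <= z) ==> (y \in R)].

Definition run (n : nat) (O R : {set 'I_n}) : bool :=
  maxset (fun S : {set 'I_n} => (S \subset ~: O) && consecutive S) R.

Definition farthest (n : nat) (O : {set 'I_n}) : {set 'I_n} :=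
  [set x | (x \notin O) &&
           [forall y, (y \notin O) ==> (distance O y <= distance O x)]].

(* Run lengths are compared only among the runs that contain a place of
   maximal distance. *)
Definition farthest_in_longest_run (n : nat) (O : {set 'I_n}) : {set 'I_n} :=
  [set x in farthest O |
     [exists R : {set 'I_n}, [&& run O R, x \in R &
       [forall y in farthest O, forall S : {set 'I_n},
          (run O S && (y \in S)) ==> (#|S| <= #|R|)]]]].

(* A filling is a permutation [x]: the person of index [t] is number t + 1 to
   arrive and takes the place [x t].  [occupied x t] is the set of places taken
   by the first [t] persons. *)
Definition occupied (n : nat) (x : {perm 'I_n}) (t : nat) : {set 'I_n} :=
  [set x s | s : 'I_n & s < t].

Definition basic_polite (n : nat) (x : {perm 'I_n}) : bool :=
  [forall t : 'I_n, (0 < t) ==> (x t \in farthest (occupied x t))].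

Definition modified_polite (n : nat) (x : {perm 'I_n}) : bool :=
  [forall t : 'I_n,
     (0 < t) ==> (x t \in farthest_in_longest_run (occupied x t))].

Definition starts_leftmost (n : nat) (x : {perm 'I_n}) : bool :=
  [exists t : 'I_n, (t == 0 :> nat) && (x t == 0 :> nat)].

Definition starts_rightmost (n : nat) (x : {perm 'I_n}) : bool :=
  [exists t : 'I_n, (t == 0 :> nat) && (x t == n.-1 :> nat)].

Definition A095240 (n : nat) : nat :=
  #|[set x : {perm 'I_n} | modified_polite x &&
                           (starts_leftmost x || starts_rightmost x)]|.

(* The numbers b_{p,k} and d_{p,k}, read off a filling [x] of [p] places; for
   basic polite fillings starting leftmost they do not depend on [x]. *)
Definition b_num (p : nat) (x : {perm 'I_p}) (k : nat) : nat :=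
  #|[set t : 'I_p | (0 < t) && (distance (occupied x t) (x t) == k)]|.

(* Times with no person seated (no distances) or with all [p] persons seated
   (no empty places) are irrelevant, so t ranges over 1, ..., p - 1. *)
Definition d_num (p : nat) (x : {perm 'I_p}) (k : nat) : nat :=
  #|[set P : {set 'I_p} |
      [exists y : 'I_p, exists z : 'I_p,
        [&& z == y.+1 :> nat, P == [set y; z] &
          [exists t : 'I_p,
            [&& 0 < t, y \notin occupied x t, z \notin occupied x t,
                distance (occupied x t) y == k &
                distance (occupied x t) z == k]]]]]|.

(* Statements about all basic polite fillings starting leftmost are not
   vacuous. *)
Lemma basic_polite_leftmost_exists (n : nat) :
  0 < n -> exists x : {perm 'I_n}, basic_polite x && starts_leftmost x.
Proof.
case: n => [//|n] _.
have H m : m < n.+1 -> exists x : {perm 'I_n.+1}, starts_leftmost x /\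
    forall t : 'I_n.+1, 0 < t <= m -> x t \in farthest (occupied x t).
  elim: m => [_|m IHm lt_m].
    exists 1%g; split; last by move=> t; case: (val t).
    by apply/existsP; exists ord0; rewrite perm1 eqxx.
  have [x [x0 xP]] := IHm (ltnW lt_m).
  pose u := Ordinal lt_m.
  have occE (w : {perm 'I_n.+1}) t s : (w s \in occupied w t) = (s < t).
    by rewrite /occupied mem_imset ?inE //; apply: perm_inj.
  have [y yF] : exists y, y \in farthest (occupied x u).
    have uO : x u \notin occupied x u by rewrite occE ltnn.
    case: (@arg_maxnP _ (x u) (fun y => y \notin occupied x u)
             (distance (occupied x u)) uO) => y yO ymax.
    exists y; rewrite inE yO; apply/forallP => z; apply/implyP; exact: ymax.
  pose v := (x^-1)%g y.
  have yE : y = x v by rewrite /v permKV.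
  have le_uv : u <= v.
    by move: yF; rewrite inE yE occE -leqNgt => /andP[].
  pose w := (tperm u v * x)%g.
  have wE (s : 'I_n.+1) : s < u -> w s = x s.
    move=> lt_su; rewrite permM tpermD //.
      by apply/eqP => E; rewrite -E ltnn in lt_su.
    by apply/eqP => E; rewrite -E ltnNge le_uv in lt_su.
  have owE t : t <= u -> occupied w t = occupied x t.
    move=> le_tu; apply: eq_in_imset => s; rewrite inE => lt_st.
    by apply: wE; apply: leq_trans le_tu.
  exists w; split.
    case/existsP: x0 => t /andP[t0 xt0]; apply/existsP; exists t.
    by rewrite t0 wE // (eqP t0).
  move=> t /andP[t_gt0]; rewrite leq_eqVlt => /orP[/eqP tE|lt_t].
    have -> : t = u by apply: val_inj.
    by rewrite owE // permM tpermL -yE.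
  by rewrite owE ?wE ?xP ?t_gt0 //; apply: ltnW.
have [x [x0 xP]] := H n (ltnSn n).
exists x; rewrite x0 andbT; apply/forallP => t; apply/implyP => t_gt0.
by apply: xP; rewrite t_gt0 -ltnS ltn_ord.
Qed.

(* Main.v *)
Require Import Defs.
From mathcomp Require Import all_boot all_fingroup all_algebra.
From mathcomp Require Import zify.

Set Implicit Arguments.
Unset Strict Implicit.
Unset Printing Implicit Defensive.

(** Once both end places are taken, a run of length L > 0 between two occupied
    places has maximal distance k = uphalf L, attained at its middle place (L odd)
    or its two middle places (L = 2k), and taking one of these leaves runs of
    lengths (L - 1)/2 and L/2, rounded down.  Hence the multiset of runs that are
    ever split does not depend on the choices: b_k counts those of length 2k or
    2k - 1, d_k those of length 2k, i.e. the pairs of middle places.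

    The modified rule always splits a run of the greatest length M, and this lowers
    by one the remaining b_k, k = uphalf M, and also d_k if M is even.  There are
    2 d_k choices if M = 2k, and b_k choices (with d_k = 0) if M = 2k - 1, so
    prod_k 2^d_k d_k! (b_k - d_k)! satisfies the same recursion as the number of
    completions.  The factor 2 is the choice of the first end; the second person
    is forced to take the other end. *)

(** * Sums along the repeated halving of a run length *)

(** The recursion is not structural in [L], hence the fuel; fuel [L] suffices because both remaining
    runs are shorter than [L]. *)
Fixpoint halving_rec (w : nat -> nat) (fuel L : nat) : nat :=
  if fuel is f.+1 then
    if L == 0 then 0 else w L + (halving_rec w f L.-1./2 + halving_rec w f L./2)
  else 0.

(* The sum of [w] over the lengths of all runs split while a run of length [L]
   is filled. *)
Definition halving_sum (w : nat -> nat) (L : nat) : nat := halving_rec w L L.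

Lemma halving_recE (w : nat -> nat) (f L : nat) :
  L <= f -> halving_rec w f L = halving_sum w L.
Proof.
rewrite /halving_sum; elim: f {-2}f (leqnn f) L => [|N IHN] [|f] //= le_fN [|L] //= le_Lf.
by rewrite !(IHN f) ?(IHN L) //; lia.
Qed.

Lemma halving_sumE (w : nat -> nat) (L : nat) :
  0 < L ->
  halving_sum w L = w L + (halving_sum w L.-1./2 + halving_sum w L./2).
Proof.
by case: L => [//|L] _; rewrite {1}/halving_sum [LHS]/= !halving_recE //; lia.
Qed.

(** All later splits concern runs shorter than [M], where [w] vanishes, so only the first split can
    contribute. *)
Lemma halving_sum_top (w : nat -> nat) (M L : nat) :
  (forall l, l < M -> w l = 0) -> 0 < L <= M -> halving_sum w L = w L.
Proof.
move=> w0; have hs0 l : l < M -> halving_sum w l = 0.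
  elim/ltn_ind: l => -[//|l] IH ltlM.
  by rewrite halving_sumE // w0 // !IH //; lia.
by case/andP=> L0 leLM; rewrite halving_sumE // !hs0 ?addn0 //; lia.
Qed.

(** * Distances and gaps between neighbouring occupied places *)

Lemma leq_bigmin (I : finType) (A : {pred I}) (f : I -> nat) (m d : nat) :
  (d <= \big[minn/m]_(i in A) f i) = (d <= m) && [forall i in A, d <= f i].
Proof.
have -> : [forall i in A, d <= f i] =
    all (fun i => (i \in A) ==> (d <= f i)) (index_enum I).
  apply/forallP/allP => [H i _|H i]; first exact: H.
  by apply: H; rewrite mem_index_enum.
elim: (index_enum I) => [|i s IHs]; first by rewrite big_nil andbT.
rewrite big_cons /=; case: (i \in A) => //=.
by rewrite leq_min IHs andbCA.
Qed.

(** A run is encoded by the two occupied places that bound it, so that lengths and distances become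
    linear expressions. Adjacent occupied places form a gap of length 0. *)
Definition gap (n : nat) (O : {set 'I_n}) (g : 'I_n * 'I_n) : bool :=
  [&& g.1 \in O, g.2 \in O, g.1 < g.2 &
      [forall c in O, (c <= g.1) || (g.2 <= c)]].

Definition inside (n : nat) (g : 'I_n * 'I_n) (y : 'I_n) : bool :=
  g.1 < y < g.2.

Definition gap_length (n : nat) (g : 'I_n * 'I_n) : nat := (g.2 - g.1).-1.

Lemma gapP (n : nat) (O : {set 'I_n}) (a b : 'I_n) :
  reflect [/\ a \in O, b \in O, a < b & forall c : 'I_n, c \in O -> c <= a \/ b <= c]
          (gap O (a, b)).
Proof.
apply: (iffP and4P) => /= -[aO bO ltab H]; split=> //.
  by move=> c cO; apply/orP; move/forall_inP: H; apply.
by apply/forall_inP => c /H/orP.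
Qed.

Lemma inside_gap_notin (n : nat) (O : {set 'I_n}) (g : 'I_n * 'I_n) (y : 'I_n) :
  gap O g -> inside g y -> y \notin O.
Proof.
case: g => a b /gapP[_ _ _ H]; rewrite /inside /= => aby.
by apply/negP => /H; lia.
Qed.

Lemma gap_inj (n : nat) (O : {set 'I_n}) (g h : 'I_n * 'I_n) (y : 'I_n) :
  gap O g -> gap O h -> inside g y -> inside h y -> g = h.
Proof.
case: g h => [a b] [c d] /gapP[aO bO _ Hab] /gapP[cO dO _ Hcd].
rewrite /inside /= => aby cdy.
move: (Hab c cO) (Hab d dO) (Hcd a aO) (Hcd b bO) => *.
by congr pair; apply: ord_inj; lia.
Qed.

(** The nearest occupied places on either side of [y] bound the gap; they exist because both ends
    are occupied. *)
Lemma gap_exists (n : nat) (O : {set 'I_n.+1}) (y : 'I_n.+1) :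
  ord0 \in O -> ord_max \in O -> y \notin O -> exists2 g, gap O g & inside g y.
Proof.
move=> O0 Om yO.
have neq c : c \in O -> (c == y :> nat) = false.
  by move=> cO; apply/negP => /eqP/ord_inj E; rewrite -E cO in yO.
have P0 : (ord0 \in O) && (@ord0 n < y) by rewrite O0 /=; have /= := neq _ O0; rewrite lt0n eq_sym => ->.
have Pm : (ord_max \in O) && (y < @ord_max n).
  by rewrite Om /=; have /= := neq _ Om; have := ltn_ord y; rewrite ltnS leq_eqVlt eq_sym => /orP[->//|->].
case: (@arg_maxnP _ ord0 (fun c => (c \in O) && (c < y)) val P0) => a /andP[aO ltay] amax.
case: (@arg_minnP _ ord_max (fun c => (c \in O) && (y < c)) val Pm) => b /andP[bO ltyb] bmin.
exists (a, b); last by rewrite /inside ltay.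
apply/gapP; split=> //; first exact: ltn_trans ltyb.
move=> c cO; move: (neq c cO) (amax c) (bmin c); rewrite cO /=.
by case: (ltngtP c y) => // _ _ ; [move=> /(_ isT); left | move=> _ /(_ isT); right].
Qed.

Lemma distance_gap (n : nat) (O : {set 'I_n}) (g : 'I_n * 'I_n) (y : 'I_n) :
  gap O g -> inside g y -> distance O y = minn (y - g.1) (g.2 - y).
Proof.
case: g => a b /gapP[aO bO _ H]; rewrite /inside /= => aby.
have [ya yb] := (ltn_ord a, ltn_ord b).
apply/eqP; rewrite eqn_leq; apply/andP; split.
  have := leqnn (distance O y); rewrite {2}/distance leq_bigmin.
  by case/andP=> _ /forall_inP D; move: (D a aO) (D b bO); lia.
(* The default value [n] of the minimum does no harm, since [b < n]. *)
rewrite leq_bigmin; apply/andP; split; first by lia.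
by apply/forall_inP => c /H; lia.
Qed.

(** A gap ending at the new place [y] cannot reach past [a] or [b], and a gap not ending at [y] was
    a gap before. *)
Lemma gap_insert (n : nat) (O : {set 'I_n}) (a b y : 'I_n) (g : 'I_n * 'I_n) :
  gap O (a, b) -> inside (a, b) y ->
  gap (y |: O) g = [|| g == (a, y), g == (y, b) | gap O g && (g != (a, b))].
Proof.
move=> gab aby; have yO := inside_gap_notin gab aby.
case/gapP: gab => aO bO _ H; move: aby; rewrite /inside /= => aby.
case: g => c d; rewrite !xpair_eqE -!val_eqE /=; apply/gapP/idP.
  case=> cO dO ltcd Hcd.
  have [] := (Hcd y (setU11 _ _), Hcd a (setU1r _ aO)).
  have := Hcd b (setU1r _ bO).
  move: cO dO; rewrite !inE => /predU1P[Ec|cO] /predU1P[Ed|dO]; subst.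
  - by rewrite ltnn in ltcd.
  - by have := H d dO; lia.
  - by have := H c cO; lia.
  move: (H c cO) (H d dO) => Hc Hd Hb Hy Ha.
  rewrite (_ : gap _ _); first by lia.
  by apply/gapP; split=> // e eO; apply: Hcd; rewrite setU1r.
case/or3P.
- case/andP=> /eqP/ord_inj-> /eqP/ord_inj->; split; rewrite ?inE ?eqxx ?aO ?orbT //; first by lia.
  by move=> e; rewrite !inE => /orP[/eqP->|/H]; lia.
- case/andP=> /eqP/ord_inj-> /eqP/ord_inj->; split; rewrite ?inE ?eqxx ?bO ?orbT //; first by lia.
  by move=> e; rewrite !inE => /orP[/eqP->|/H]; lia.
case/andP=> /gapP[cO dO ltcd Hcd] ne; split; rewrite ?inE ?cO ?dO ?orbT //.
move=> e; rewrite !inE => /orP[/eqP->|/Hcd//].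
by move: (Hcd a aO) (Hcd b bO) (H c cO) (H d dO); lia.
Qed.

Lemma gap_center (n : nat) (O : {set 'I_n}) (g : 'I_n * 'I_n) :
  gap O g -> 0 < gap_length g ->
  exists2 y, inside g y & distance O y = uphalf (gap_length g).
Proof.
rewrite /gap_length => gg L0; have hb := ltn_ord g.2.
(* The middle place, or the left one of the two middle places. *)
have ltyn : g.1 + uphalf (g.2 - g.1).-1 < n by lia.
have yg : inside g (Ordinal ltyn) by rewrite /inside /=; lia.
by exists (Ordinal ltyn) => //; rewrite (distance_gap gg yg) /=; lia.
Qed.

Lemma distance_gap_le (n : nat) (O : {set 'I_n}) (g : 'I_n * 'I_n) (y : 'I_n) :
  gap O g -> inside g y -> distance O y <= uphalf (gap_length g).
Proof. by move=> gg yg; rewrite (distance_gap gg yg) /gap_length; lia. Qed.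

(* Every empty place then lies between two occupied ones. *)
Definition framed (n : nat) (O : {set 'I_n.+1}) : bool :=
  (ord0 \in O) && (ord_max \in O).

(** * The two politeness rules in terms of gaps *)

(** The largest distance inside a nonempty gap is half its length, rounded up, and it is attained;
    the overall maximum is the greatest of these values. *)
Lemma farthest_gap (n : nat) (O : {set 'I_n.+1}) (g : 'I_n.+1 * 'I_n.+1)
    (y : 'I_n.+1) :
  framed O -> gap O g -> inside g y ->
  (y \in farthest O) = (distance O y == uphalf (gap_length g)) &&
    [forall h, gap O h ==> (uphalf (gap_length h) <= uphalf (gap_length g))].
Proof.
case/andP=> O0 Om gg yg; have yO := inside_gap_notin gg yg.
rewrite inE yO /=; apply/forallP/andP => [ymax|[/eqP dy gmax] z]; last first.
  apply/implyP => zO; have [h gh zh] := gap_exists O0 Om zO.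
  apply: leq_trans (distance_gap_le gh zh) _.
  by rewrite dy; move/forallP: gmax => /(_ h)/implyP; apply.
have maxD h : gap O h -> uphalf (gap_length h) <= distance O y.
  move=> gh; case: (posnP (gap_length h)) => [->//|L0].
  have [z zh <-] := gap_center gh L0.
  by move: (ymax z); rewrite (inside_gap_notin gh zh).
have E : distance O y = uphalf (gap_length g).
  by apply/eqP; rewrite eqn_leq distance_gap_le //= maxD.
by rewrite E eqxx; split=> //; apply/forallP => h; apply/implyP => /maxD; rewrite E.
Qed.

(** A consecutive set of empty places containing [y] cannot cross an endpoint of the gap, and the
    interior of the gap is itself such a set, hence the only maximal one. *)
Lemma run_gap (n : nat) (O R : {set 'I_n}) (g : 'I_n * 'I_n) (y : 'I_n) :
  gap O g -> inside g y ->
  run O R && (y \in R) = (R == [set z | inside g z]).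
Proof.
case: g => a b gg yg; set I := [set z | _].
have sub (S : {set 'I_n}) :
    S \subset ~: O -> consecutive S -> y \in S -> S \subset I.
  move=> SO Sc yS; apply/subsetP => z zS; rewrite inE.
  case/gapP: (gg) => aO bO _ _; move: (yg); rewrite /inside /= => /andP[ay yb].
  have notS c : c \in O -> c \notin S.
    by move=> cO; apply/negP => /(subsetP SO); rewrite inE cO.
  rewrite !ltnNge; apply/andP; split; apply/negP => H.
    have := notS _ aO; move/forall_inP: Sc => /(_ z zS)/forall_inP/(_ y yS).
    by move/forallP/(_ a); rewrite H ltnW //= => ->.
  have := notS _ bO; move/forall_inP: Sc => /(_ y yS)/forall_inP/(_ z zS).
  by move/forallP/(_ b); rewrite H ltnW //= => ->.
have IO : I \subset ~: O.
  by apply/subsetP => z; rewrite !inE => zg; apply: inside_gap_notin zg.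
have Ic : consecutive I.
  apply/forall_inP => x; rewrite inE /inside /= => xI.
  apply/forall_inP => z; rewrite inE /inside /= => zI.
  by apply/forallP => t; apply/implyP; rewrite inE /inside /=; lia.
have yI : y \in I by rewrite inE.
apply/andP/eqP => [[/maxsetP[/andP[RO Rc] Rmax] yR]|->].
  by symmetry; apply: Rmax; [rewrite IO | apply: sub].
split=> //; apply/maxsetP; split; first by rewrite IO.
move=> S /andP[SO Sc] IS; apply/eqP; rewrite eqEsubset IS andbT.
by apply: sub => //; apply: (subsetP IS).
Qed.

Lemma card_inside (n : nat) (g : 'I_n * 'I_n) :
  #|[set z | inside g z]| = gap_length g.
Proof.
rewrite cardsE -sum1_card /gap_length /inside.
rewrite -(big_ord_widen_cond n (fun z => g.1 < z) (fun=> 1) (ltnW (ltn_ord g.2))).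
by rewrite -(big_geq_mkord _ _ xpredT (fun=> 1)) sum_nat_const_nat muln1; lia.
Qed.

(** The rule compares only runs with a farthest place, yet this amounts to comparing all gaps: a gap
    longer than one of maximal [uphalf] has the same [uphalf], so its middle is a farthest place
    too. *)
Lemma farthest_in_longest_run_gap (n : nat) (O : {set 'I_n.+1})
    (g : 'I_n.+1 * 'I_n.+1) (y : 'I_n.+1) :
  framed O -> gap O g -> inside g y ->
  (y \in farthest_in_longest_run O) =
    (distance O y == uphalf (gap_length g)) &&
    [forall h, gap O h ==> (gap_length h <= gap_length g)].
Proof.
move=> fO gg yg; have [O0 Om] := andP fO.
rewrite inE; apply/andP/andP => [[yF /existsP[R /and3P[Rr yR /forall_inP H]]]|[dy gmax]].
  move: (yF); rewrite (farthest_gap fO gg yg) => /andP[dy gmax]; split=> //.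
  apply/forallP => h; apply/implyP => gh; rewrite leqNgt; apply/negP => lt_gh.
  have uE : uphalf (gap_length h) = uphalf (gap_length g).
    by move/forallP: gmax => /(_ h); rewrite gh /=; lia.
  have [|z zh dz] := gap_center gh; first by lia.
  have zF : z \in farthest O by rewrite (farthest_gap fO gh zh) dz eqxx uE.
  have := H z zF; move/forallP/(_ [set t | inside h t]).
  rewrite (run_gap _ gh zh) eqxx /= card_inside.
  have /eqP-> : R == [set t | inside g t] by rewrite -(run_gap _ gg yg) Rr.
  by rewrite card_inside leqNgt lt_gh.
have gmaxP h : gap O h -> gap_length h <= gap_length g.
  by move/forallP: gmax => /(_ h)/implyP.
split.
  rewrite (farthest_gap fO gg yg) dy /=.
  by apply/forallP => h; apply/implyP => /gmaxP; lia.
apply/existsP; exists [set t | inside g t].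
have /andP[-> ->] /= : run O [set t | inside g t] && (y \in [set t | inside g t]).
  by rewrite (run_gap _ gg yg).
apply/forall_inP => z; rewrite inE => /andP[zO _]; apply/forallP => S.
have [h gh zh] := gap_exists O0 Om zO.
by apply/implyP; rewrite (run_gap _ gh zh) => /eqP->; rewrite !card_inside gmaxP.
Qed.

(** * Sums over the splits still to come *)

(** For framed [O], the total weight of all splits from [O] to the full row, each run being split at
    a middle place. *)
Definition gap_sum (n : nat) (w : nat -> nat) (O : {set 'I_n}) : nat :=
  \sum_(g | gap O g) halving_sum w (gap_length g).

(** Splitting at a middle place leaves the two lengths of the recursion for [halving_sum], in one
    order or the other; all other gaps stay. *)
Lemma gap_sum_insert (n : nat) (w : nat -> nat) (O : {set 'I_n})
    (g : 'I_n * 'I_n) (y : 'I_n) :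
  gap O g -> inside g y -> distance O y = uphalf (gap_length g) ->
  gap_sum w O = w (gap_length g) + gap_sum w (y |: O).
Proof.
case: g => a b gg yg dy; have yO := inside_gap_notin gg yg.
rewrite /gap_sum (bigD1 (a, b)) //= [in RHS](bigD1 (a, y)) /=; last first.
  by rewrite (gap_insert _ gg yg) eqxx.
rewrite [in RHS](bigD1 (y, b)) /=; last first.
  rewrite (gap_insert _ gg yg) eqxx orbT /= xpair_eqE -!val_eqE /=.
  by move: yg; rewrite /inside /=; lia.
rewrite [in RHS](eq_bigl (fun h => gap O h && (h != (a, b)))) => [|h]; last first.
  rewrite (gap_insert _ gg yg); case: (h =P (a, y)) => [->|_] /=.
    by apply/esym/negbTE/negP => /andP[/gapP[_ yO']]; rewrite yO' in yO.
  case: (h =P (y, b)) => [->|_] /=; last by rewrite !andbT.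
  by apply/esym/negbTE/negP => /andP[/gapP[yO']]; rewrite yO' in yO.
move: yg dy (distance_gap gg yg); rewrite /inside /gap_length /= => yab -> E.
rewrite halving_sumE -?addnA; last by lia.
congr (_ + _); rewrite !addnA; congr (_ + _).
have [[-> ->]//|[-> ->]] :
  ((y - a).-1 = (b - a).-1.-1./2 /\ (b - y).-1 = (b - a).-1./2) \/
  ((y - a).-1 = (b - a).-1./2 /\ (b - y).-1 = (b - a).-1.-1./2) by lia.
exact: addnC.
Qed.

(** Turns the sum into a count of longest gaps: each contributes [w M] once, and its later splits
    contribute nothing. *)
Lemma gap_sum_top (n : nat) (w : nat -> nat) (O : {set 'I_n}) (M : nat) :
  0 < M -> (forall h, gap O h -> gap_length h <= M) ->
  (forall l, l < M -> w l = 0) ->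
  gap_sum w O = #|[set h | gap O h & gap_length h == M]| * w M.
Proof.
move=> M0 leM w0; rewrite -sum_nat_const /gap_sum.
rewrite [RHS](eq_bigl (fun h => gap O h && (gap_length h == M))); last first.
  by move=> h; rewrite inE.
rewrite [RHS]big_mkcondr; apply: eq_bigr => h /leM.
case: eqP => [->|neM leh]; first by rewrite (@halving_sum_top w M) ?M0 ?leqnn.
case: (posnP (gap_length h)) => [->//|h0].
by rewrite (@halving_sum_top w M) ?h0 // w0 //; lia.
Qed.

(** * The number of choices under the modified rule *)

Lemma card_center (n : nat) (O : {set 'I_n}) (g : 'I_n * 'I_n) :
  gap O g -> 0 < gap_length g ->
  #|[set y | inside g y & distance O y == uphalf (gap_length g)]| =
    (~~ odd (gap_length g)).+1.
Proof.
case: g => a b gg; rewrite /gap_length /= => L0; have hb := ltn_ord b.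
have ltpn : a + uphalf (b - a).-1 < n by lia.
have ltqn : b - uphalf (b - a).-1 < n by lia.
(* The places at distance [uphalf] of the length from the left and from the right endpoint; they
   coincide exactly when the length is odd. *)
have -> : [set y | inside (a, b) y & distance O y == uphalf (b - a).-1] =
    [set Ordinal ltpn; Ordinal ltqn].
  apply/setP => y; rewrite !inE -!val_eqE /=.
  case: (boolP (inside (a, b) y)) => [yg|].
    by rewrite (distance_gap gg yg); move: yg; rewrite /inside /=; lia.
  by rewrite /inside /=; lia.
by rewrite cards2 -val_eqE /=; congr (nat_of_bool _).+1; lia.
Qed.

(** Double counting: each admissible place lies in exactly one gap of length [M], and each such gap
    has one or two middle places. *)
Lemma card_farthest_in_longest_run (n : nat) (O : {set 'I_n.+1}) (M : nat) :
  framed O -> 0 < M -> (forall h, gap O h -> gap_length h <= M) ->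
  (exists2 h, gap O h & gap_length h = M) ->
  #|farthest_in_longest_run O| =
    #|[set h | gap O h & gap_length h == M]| * (~~ odd M).+1.
Proof.
move=> fO M0 leM [g gg gM]; have [O0 Om] := andP fO.
set F := farthest_in_longest_run O; set G := [set h | _ & _].
have FE h y : gap O h -> inside h y ->
    (y \in F) = (distance O y == uphalf M) && (gap_length h == M).
  move=> gh yh; rewrite (farthest_in_longest_run_gap fO gh yh).
  have -> : [forall k, gap O k ==> (gap_length k <= gap_length h)] =
      (gap_length h == M).
    apply/forallP/eqP => [H|hM k]; last by apply/implyP; rewrite hM; apply: leM.
    by apply/eqP; rewrite eqn_leq leM //= -gM; have := H g; rewrite gg.
  by case: (gap_length h =P M) => [->|]; rewrite ?andbF.
rewrite -sum1_card (eq_bigr (fun y => \sum_(h in G | inside h y) 1)); last first.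
  move=> y yF; have yO : y \notin O.
    by move: yF; rewrite inE => /andP[]; rewrite inE => /andP[].
  have [h gh yh] := gap_exists O0 Om yO.
  have hM : gap_length h == M by move: yF; rewrite (FE h) // => /andP[].
  rewrite (big_pred1 h) // => k; rewrite inE /=; apply/idP/eqP => [|->].
    by case/andP=> /andP[gk _] yk; apply: (gap_inj gk gh yk yh).
  by rewrite gh hM yh.
rewrite (exchange_big_dep (mem G)) //=; last by move=> y h _ /andP[].
rewrite -sum_nat_const; apply: eq_bigr => h.
rewrite inE => /andP[gh /eqP hM].
rewrite -[in RHS]hM -(card_center gh) ?hM // -sum1_card; apply: eq_bigl => y.
rewrite gh eqxx [in RHS]inE /=; case: (boolP (inside h y)) => yh; rewrite ?andbF //=.
by rewrite andbT (FE h) // hM eqxx andbT.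
Qed.

(** * The recursion satisfied by the product *)

Definition weight (b d : nat) : nat := 2 ^ d * d`! * (b - d)`!.

(* The two sums are the values of b_j and d_j for the rest of a filling that has
   reached the set [O]. *)
Definition potential (n : nat) (O : {set 'I_n}) : nat :=
  \prod_(1 <= j < n)
    weight (gap_sum (fun L => uphalf L == j) O) (gap_sum (fun L => L == j.*2) O).

(** Every admissible choice splits a gap of the greatest length [M] and changes only the factor
    [k = uphalf M], always in the same way. The sum is therefore the number of choices times one
    common value. *)
Lemma potential_step (n : nat) (O : {set 'I_n.+1}) :
  framed O -> O != setT ->
  \sum_(y in farthest_in_longest_run O) potential (y |: O) = potential O.
Proof.
move=> fO OT; have [O0 Om] := andP fO.
have [y0 y0O] : exists y, y \notin O.
  apply/existsP; rewrite -negb_forall; apply: contra OT => /forallP H.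
  by apply/eqP/setP => y; rewrite inE H.
have [g0 gg0 y0g0] := gap_exists O0 Om y0O.
case: (@arg_maxnP _ g0 (gap O) (@gap_length n.+1) gg0) => g gg gmax.
set M := gap_length g in gmax *; set k := uphalf M.
have M0 : 0 < M.
  by have := gmax _ gg0; move: y0g0; rewrite /M /inside /gap_length /=; lia.
have k0 : 0 < k by rewrite /k; lia.
have ltkn : k < n.+1.
  apply: leq_ltn_trans (ltn_ord g.2); rewrite /k /M /gap_length.
  by move: (nat_of_ord g.2) (nat_of_ord g.1) => p q; clear; lia.
have k_in : k \in index_iota 1 n.+1 by rewrite mem_index_iota k0.
have Mk : (M == k.*2) = ~~ odd M by rewrite /k; move: (M) => m; clear; lia.
set F := farthest_in_longest_run O.
have step w y : y \in F -> gap_sum w O = w M + gap_sum w (y |: O).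
  move=> yF; have yO : y \notin O.
    by move: yF; rewrite inE => /andP[]; rewrite inE => /andP[].
  have [h gh yh] := gap_exists O0 Om yO.
  move: yF; rewrite /F (farthest_in_longest_run_gap fO gh yh) => /andP[/eqP dy].
  move/forallP/(_ g); rewrite gg /= => le_gh.
  have hM : gap_length h = M by apply/eqP; rewrite eqn_leq le_gh andbT; apply: gmax.
  by rewrite (gap_sum_insert w gh yh dy) hM.
pose B (O : {set 'I_n.+1}) j := gap_sum (fun L => uphalf L == j) O.
pose D (O : {set 'I_n.+1}) j := gap_sum (fun L => L == j.*2) O.
pose rest := \prod_(j <- index_iota 1 n.+1 | j != k) weight (B O j) (D O j).
have after y : y \in F ->
    potential (y |: O) = weight (B O k).-1 (D O k - ~~ odd M) * rest.
  move=> yF; rewrite /potential (bigD1_seq k) ?iota_uniq //=; congr (_ * _).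
    have -> : gap_sum (fun L => uphalf L == k) (y |: O) = (B O k).-1.
      by rewrite /B (step _ y) //= -/k eqxx.
    have -> // : gap_sum (fun L => L == k.*2) (y |: O) = D O k - ~~ odd M.
    rewrite /D (step (fun L => L == k.*2 : nat) y) //=.
    rewrite Mk.
    by rewrite addKn.
  apply: eq_bigr => j jk; rewrite /B /D (step (fun L => uphalf L == j : nat) y) //.
  rewrite (step (fun L => L == j.*2 : nat) y) //=.
  have -> : (uphalf M == j) = false by rewrite -/k eq_sym; apply/negbTE.
  have -> // : (M == j.*2) = false.
  by move: jk; rewrite /k; move: (M) => m; clear; lia.
rewrite (eq_bigr _ after) sum_nat_const mulnA /potential.
rewrite (bigD1_seq k) ?iota_uniq //= -/rest; congr (_ * _).
rewrite -/(B O k) -/(D O k) (card_farthest_in_longest_run fO M0 gmax); last by exists g.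
set c := #|_|.
have c0 : 0 < c by apply/card_gt0P; exists g; rewrite inE gg eqxx.
(* No gap is longer than [M], and [M <= 2k]; so length [2k] occurs only among the [c] longest gaps,
   and only if [M] is even. *)
have DE : D O k = c * ~~ odd M.
  rewrite -Mk /D (gap_sum_top M0 gmax) // => l.
  by rewrite /k; move: (M) => m; clear; lia.
have cfact : c * c.-1`! = c`! by case: (c) c0.
case: (boolP (odd M)) => oM /=.
  (* For [M = 2k - 1] no shorter length has [uphalf] equal to [k]. *)
  have BE : B O k = c.
    rewrite /B (gap_sum_top M0 gmax) ?eqxx ?muln1 // => l.
    by move: oM; rewrite /k; move: (M) => m; clear; lia.
  have -> : D O k = 0 by rewrite DE oM muln0.
  by rewrite /weight BE !subn0 !mul1n muln1 cfact.
have Dc : D O k = c by rewrite DE oM muln1.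
have -> : weight (B O k) (D O k) = 2 ^ c * (c * c.-1`!) * (B O k - c)`!.
  by rewrite cfact Dc.
rewrite /weight Dc subn1 -[X in 2 ^ X * (_ * _)](prednK c0) expnS.
(* For even [M] both numbers drop by one, so the last factorial is unchanged and the [2 * c] choices
   restore [2 ^ c] and [c!]. *)
have -> : (B O k).-1 - c.-1 = B O k - c by rewrite -subn1 -subnDA add1n prednK.
by rewrite !mulnA [c * 2]mulnC -!mulnA [c * (_ * _)]mulnCA.
Qed.

Lemma gap_sum_setT (n : nat) (w : nat -> nat) : gap_sum w [set: 'I_n] = 0.
Proof.
rewrite /gap_sum big1 // => g gg.
case: (posnP (gap_length g)) => [->//|/(gap_center gg)[y yg _]].
by have := inside_gap_notin gg yg; rewrite inE.
Qed.

Lemma potential_setT (n : nat) : potential [set: 'I_n] = 1.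
Proof. by rewrite /potential big1 // => j _; rewrite !gap_sum_setT. Qed.

(** * Counting fillings by completing prefixes *)

Lemma mem_occupied (n : nat) (x : {perm 'I_n}) (t : nat) (s : 'I_n) :
  (x s \in occupied x t) = (s < t).
Proof. by rewrite /occupied mem_imset ?inE //; apply: perm_inj. Qed.

Lemma mem_occupiedV (n : nat) (x : {perm 'I_n}) (t : nat) (y : 'I_n) :
  (y \in occupied x t) = ((x^-1)%g y < t).
Proof. by rewrite -{1}[y](permKV x) mem_occupied. Qed.

Lemma occupied0 (n : nat) (x : {perm 'I_n}) : occupied x 0 = set0.
Proof. by apply/setP => y; rewrite mem_occupiedV inE. Qed.

Lemma occupied_full (n : nat) (x : {perm 'I_n}) : occupied x n = setT.
Proof. by apply/setP => y; rewrite mem_occupiedV inE ltn_ord. Qed.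

Lemma occupiedS (n : nat) (x : {perm 'I_n}) (t : 'I_n) :
  occupied x t.+1 = x t |: occupied x t.
Proof.
apply/setP => y; rewrite in_setU1 !mem_occupiedV ltnS leq_eqVlt; congr orb.
by rewrite [RHS]eq_sym (can2_eq (permK x) (permKV x)) eq_sym.
Qed.

Lemma occupied_agree (n : nat) (x w : {perm 'I_n}) (m : nat) :
  (forall s : 'I_n, s < m -> x s = w s) -> occupied x m = occupied w m.
Proof. by move=> xw; apply: eq_in_imset => s; rewrite inE => /xw. Qed.

(** Induction on the number of persons still to come, sorting the completions by the next place. [w]
    carries the prefix through its first [m] values, [P] is an invariant of the sets reached, and
    [Phi] obeys the same recursion as the count. *)
Lemma card_completions (n : nat) (F : {set 'I_n} -> {set 'I_n})
    (P : pred {set 'I_n}) (Phi : {set 'I_n} -> nat) :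
  (forall O y, P O -> y \in F O -> (y \notin O) && P (y |: O)) ->
  (forall O, P O -> O != setT -> \sum_(y in F O) Phi (y |: O) = Phi O) ->
  Phi setT = 1 ->
  forall (w : {perm 'I_n}) (m : nat), m <= n -> P (occupied w m) ->
  #|[set x : {perm 'I_n} |
      [forall t : 'I_n, if t < m then x t == w t else x t \in F (occupied x t)]]|
  = Phi (occupied w m).
Proof.
move=> FP FPhi PhiT w m.
elim: {m}(n - m) {-2}m w (erefl (n - m)) => [|d IHd] m w E le_mn PO.
  have {E le_mn}-> : m = n by lia.
  rewrite occupied_full PhiT (_ : [set x | _] = [set w]) ?cards1 //.
  apply/setP => x; rewrite !inE; apply/forallP/eqP => [H|-> t].
    by apply/permP => t; apply/eqP; have := H t; rewrite ltn_ord.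
  by rewrite ltn_ord.
have ltmn : m < n by lia.
pose u := Ordinal ltmn; set O := occupied w m.
have OT : O != setT.
  by apply/eqP => /setP/(_ (w u)); rewrite mem_occupied ltnn inE.
have prefix (x : {perm 'I_n}) :
    (forall t : 'I_n, if t < m then x t == w t else x t \in F (occupied x t)) ->
    occupied x m = O.
  by move=> H; apply: occupied_agree => s ltsm; have := H s; rewrite ltsm => /eqP.
rewrite -(FPhi _ PO OT) -sum1_card.
rewrite (partition_big (fun x : {perm 'I_n} => x u) (mem (F O))) => [|x]; last first.
  by rewrite inE => /forallP H; have := H u; rewrite ltnn (prefix x).
apply: eq_bigr => y yF; have /andP[yO PyO] := FP _ _ PO yF.
(* The transposition keeps the first [m] values and makes [y] the next one. *)
pose v := (w^-1)%g y; pose w' := (tperm u v * w)%g.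
have le_uv : m <= v by move: yO; rewrite mem_occupiedV -leqNgt.
have w'u : w' u = y by rewrite permM tpermL permKV.
have w'E (s : 'I_n) : s < m -> w' s = w s.
  move=> ltsm; rewrite permM tpermD //.
    by apply/eqP => Es; move: ltsm; rewrite -Es ltnn.
  by apply/eqP => Es; move: ltsm; rewrite -Es ltnNge le_uv.
have occ' : occupied w' m.+1 = y |: O.
  by rewrite (occupiedS w' u) w'u (occupied_agree w'E).
rewrite -occ' -IHd ?occ' //; last by lia.
rewrite -sum1_card; apply: eq_bigl => x; rewrite !inE.
apply/andP/forallP => [[/forallP H /eqP xu] t|H].
  have := H t; rewrite ltnS (leq_eqVlt t); case: (ltngtP t m) => [lttm|//|Et] /=.
    by rewrite w'E.
  have -> : t = u by apply: val_inj.
  by rewrite xu w'u eqxx.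
have xE (s : 'I_n) : s < m.+1 -> x s = w' s.
  by move=> ltsm; have := H s; rewrite ltsm => /eqP.
have xu : x u = y by rewrite xE.
split; last by rewrite xu.
apply/forallP => t; have := H t; rewrite ltnS (leq_eqVlt t).
case: (ltngtP t m) => [lttm|//|Et] /=; first by rewrite w'E.
have -> : t = u by apply: val_inj.
rewrite xu (occupied_agree (w := w)) // => s ltsm.
by rewrite xE ?w'E // ltnS ltnW.
Qed.

(** Telescoping: [f] drops by one exactly at the times satisfying [E] and ends at 0. *)
Lemma card_from (n m : nat) (E : pred 'I_n) (f : nat -> nat) :
  m <= n -> (forall t : 'I_n, m <= t -> f t = E t + f t.+1) -> f n = 0 ->
  #|[set t : 'I_n | (m <= t) && E t]| = f m.
Proof.
elim: {m}(n - m) {-2}m (erefl (n - m)) => [|d IHd] m Ed le_mn fS fn.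
  have -> : m = n by lia.
  by rewrite fn; apply: eq_card0 => t; rewrite inE leqNgt ltn_ord.
have ltmn : m < n by lia.
pose u := Ordinal ltmn.
rewrite (fS u) //= -IHd ?fn //; [|lia|by move=> t /ltnW/fS].
rewrite [LHS](cardsD1 u) inE /= leqnn; congr (_ + _); apply: eq_card => t.
by rewrite !inE -val_eqE /= andbA ltn_neqAle eq_sym.
Qed.

(** * The moves of the first two persons *)

Lemma distance_set1 (n : nat) (a x : 'I_n) : distance [set a] x = `|x - a|%N.
Proof.
have [xn an] := (ltn_ord x, ltn_ord a).
apply/eqP; rewrite eqn_leq; apply/andP; split.
  have := leqnn (distance [set a] x); rewrite {2}/distance leq_bigmin.
  by case/andP=> _ /forall_inP; apply; rewrite inE.
rewrite leq_bigmin; apply/andP; split; first by lia.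
by apply/forall_inP => c; rewrite inE => /eqP->.
Qed.

Lemma farthest_from_left (n : nat) :
  farthest [set (ord0 : 'I_n.+2)] = [set ord_max].
Proof.
apply/setP => x; rewrite !inE; have xn := ltn_ord x.
apply/andP/eqP => [[_ /forallP/(_ ord_max)]|->].
  rewrite inE /= !distance_set1 => H; apply: ord_inj.
  by move: H => /=; lia.
split=> //; apply/forallP => y; apply/implyP => _; have yn := ltn_ord y.
by rewrite !distance_set1 /=; lia.
Qed.

Lemma farthest_from_right (n : nat) :
  farthest [set (ord_max : 'I_n.+2)] = [set ord0].
Proof.
apply/setP => x; rewrite !inE; have xn := ltn_ord x.
apply/andP/eqP => [[_ /forallP/(_ ord0)]|->].
  rewrite inE /= !distance_set1 => H; apply: ord_inj.
  by move: H => /=; lia.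
split=> //; apply/forallP => y; apply/implyP => _; have yn := ltn_ord y.
by rewrite !distance_set1 /=; lia.
Qed.

(** The empty places form a single run, so comparing run lengths excludes nothing. *)
Lemma farthest_in_longest_run_set1 (n : nat) (O : {set 'I_n}) (y : 'I_n) :
  consecutive (~: O) -> farthest O = [set y] -> farthest_in_longest_run O = [set y].
Proof.
move=> cO fy; have yO : y \notin O.
  by have := set11 y; rewrite -fy inE => /andP[].
apply/setP => x; rewrite inE fy !inE; case: eqP => //= ->.
apply/existsP; exists (~: O); apply/and3P; split; last 2 first.
- by rewrite inE.
- apply/forall_inP => z _; apply/forallP => S; apply/implyP => /andP[/maxsetp/andP[SO _] _].
  exact: subset_leq_card.
apply/maxsetP; split; first by rewrite subxx.
by move=> S /andP[SO _] OS; apply/eqP; rewrite eqEsubset SO.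
Qed.

Lemma longest_run_from_left (n : nat) :
  farthest_in_longest_run [set (ord0 : 'I_n.+2)] = [set ord_max].
Proof.
apply: farthest_in_longest_run_set1 (farthest_from_left n).
apply/forall_inP => x; rewrite !inE -val_eqE /= => x0.
apply/forall_inP => z _; apply/forallP => y; apply/implyP => /andP[xy _].
by rewrite !inE -val_eqE /=; lia.
Qed.

Lemma longest_run_from_right (n : nat) :
  farthest_in_longest_run [set (ord_max : 'I_n.+2)] = [set ord0].
Proof.
apply: farthest_in_longest_run_set1 (farthest_from_right n).
apply/forall_inP => x _; apply/forall_inP => z; rewrite !inE -val_eqE /= => zn.
apply/forallP => y; apply/implyP => /andP[_ yz]; have := ltn_ord z.
by rewrite !inE -val_eqE /=; lia.
Qed.

(** * The count of modified polite fillings *)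

Definition ends (n : nat) : {set 'I_n.+2} := [set ord0; ord_max].

(** [card_completions] is applied from the empty row, with the condition on the first person built
    into the rule as a choice between the two ends. *)
Lemma card_modified_polite (n : nat) : A095240 n.+2 = 2 * potential (ends n).
Proof.
pose rule (O : {set 'I_n.+2}) :=
  if O == set0 then ends n else farthest_in_longest_run O.
pose P (O : {set 'I_n.+2}) :=
  [|| O == set0, O == [set ord0], O == [set ord_max] | framed O].
(* With one end taken the next move is forced, so the value is already that of [ends n]; the empty
   row has two such successors. *)
pose Phi (O : {set 'I_n.+2}) := if O == set0 then 2 * potential (ends n)
  else if framed O then potential O else potential (ends n).
have set1N0 (y : 'I_n.+2) : ([set y] == set0) = false.
  by apply/negbTE/set0Pn; exists y; rewrite inE.
have setU1N0 (y : 'I_n.+2) O : (y |: O == set0) = false.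
  by apply/negbTE/set0Pn; exists y; rewrite setU11.
have framed_ends : framed (ends n) by rewrite /framed !inE !eqxx orbT.
have framedN0 (O : {set 'I_n.+2}) : framed O -> (O == set0) = false.
  by case/andP=> O0 _; apply/negbTE/set0Pn; exists ord0.
have ends_sym : ord_max |: [set ord0] = ends n by rewrite setUC.
have rule_notin O y : P O -> y \in rule O -> (y \notin O) && P (y |: O).
  rewrite /P /rule setU1N0 => /or4P[] => [/eqP->|/eqP->|/eqP->|fO].
  - by rewrite eqxx setU0 !inE => /orP[]/eqP->; rewrite eqxx ?orbT.
  - rewrite set1N0 longest_run_from_left inE => /eqP->.
    by rewrite ends_sym framed_ends !orbT inE.
  - rewrite set1N0 longest_run_from_right inE => /eqP->.
    by rewrite -/(ends n) framed_ends !orbT inE.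
  rewrite framedN0 // inE => /andP[]; rewrite inE => /andP[-> _] _ /=.
  by case/andP: fO => O0 Om; rewrite /framed !inE O0 Om !orbT.
have Phi_step O : P O -> O != setT -> \sum_(y in rule O) Phi (y |: O) = Phi O.
  rewrite /P /rule /Phi => PO OT; under eq_bigr do rewrite setU1N0.
  case/or4P: PO OT => [/eqP->|/eqP->|/eqP->|fO] OT.
  - rewrite eqxx (eq_bigr (fun=> potential (ends n))) => [|y].
      by rewrite sum_nat_const cards2.
    by rewrite setU0 /framed !inE => /orP[]/eqP->.
  - by rewrite set1N0 longest_run_from_left big_set1 ends_sym framed_ends /framed !inE.
  - by rewrite set1N0 longest_run_from_right big_set1 -/(ends n) framed_ends /framed !inE.
  rewrite framedN0 // fO -(potential_step fO OT); apply: eq_bigr => y _.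
  by case/andP: fO => O0 Om; rewrite /framed !inE O0 Om !orbT.
have Phi_full : Phi setT = 1.
  have fT : framed [set: 'I_n.+2] by rewrite /framed !inE.
  by rewrite /Phi framedN0 // fT potential_setT.
have := card_completions rule_notin Phi_step Phi_full (w := 1%g) (leq0n _).
rewrite occupied0 {1}/P {1}/Phi eqxx => /(_ isT) <-; apply: eq_card => x; rewrite !inE.
have rule0 : (x ord0 \in rule (occupied x 0)) = starts_leftmost x || starts_rightmost x.
  rewrite /= occupied0 /rule eqxx !inE -!val_eqE /=.
  congr orb.
    apply/idP/existsP => [E|[t /andP[/eqP t0]]]; first by exists ord0.
    by rewrite (_ : t = ord0) //; apply: ord_inj.
  apply/idP/existsP => [E|[t /andP[/eqP t0]]]; first by exists ord0.
  by rewrite (_ : t = ord0) //; apply: ord_inj.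
have ruleS (t : 'I_n.+2) : 0 < t ->
    rule (occupied x t) = farthest_in_longest_run (occupied x t).
  move=> t0; rewrite /rule ifN //; apply/set0Pn; exists (x ord0).
  by rewrite mem_occupied.
apply/andP/forallP => [[/forallP H E] t|H].
  case: (posnP t) => [t0|t0]; last by rewrite ruleS //; have := H t; rewrite t0.
  by rewrite (_ : t = ord0) ?rule0 //; apply: ord_inj.
split; last by rewrite -rule0; apply: H.
by apply/forallP => t; apply/implyP => t0; rewrite -ruleS.
Qed.

(** * The numbers b and d of a basic polite filling *)

Lemma gap_ends (n : nat) (g : 'I_n.+2 * 'I_n.+2) :
  gap (ends n) g = (g == (ord0, ord_max)).
Proof.
case: g => a b; apply/gapP/eqP => [[]|[-> ->]].
  by rewrite !inE => /orP[]/eqP-> /orP[]/eqP-> //=; rewrite ltnn.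
rewrite !inE !eqxx orbT; split=> // c; rewrite !inE => /orP[]/eqP->; last by right.
by left.
Qed.

Lemma gap_sum_ends (n : nat) (w : nat -> nat) :
  gap_sum w (ends n) = halving_sum w n.
Proof.
rewrite /gap_sum (big_pred1 (ord0, ord_max)) => [|g]; last exact: gap_ends.
by rewrite /gap_length /=.
Qed.

Lemma gap_insert_outside (n : nat) (O : {set 'I_n}) (g : 'I_n * 'I_n) (v : 'I_n) :
  gap O g -> ~~ inside g v -> gap (v |: O) g.
Proof.
case: g => a b /gapP[aO bO ltab H]; rewrite /inside /= => vg.
apply/gapP; rewrite !in_setU1 aO bO !orbT; split=> // c.
by rewrite in_setU1 => /predU1P[->|/H//]; lia.
Qed.

Lemma occupied1_basic (n : nat) (x : {perm 'I_n.+2}) :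
  starts_leftmost x -> occupied x 1 = [set ord0].
Proof.
move=> x_left.
have x0 : x ord0 = ord0.
  case/existsP: x_left => t /andP[/eqP t0 /eqP xt0].
  have tE : t = ord0 by apply: ord_inj.
  by rewrite tE in xt0; apply: ord_inj.
by have := occupiedS x ord0; rewrite occupied0 setU0 x0.
Qed.

Lemma second_basic (n : nat) (x : {perm 'I_n.+2}) :
  basic_polite x -> starts_leftmost x ->
  x (Ordinal (isT : 1 < n.+2)) = ord_max.
Proof.
move=> xP x_left.
apply/set1P; rewrite -farthest_from_left -(occupied1_basic x_left).
by move/forallP: xP => /(_ (Ordinal (isT : 1 < n.+2))).
Qed.

Lemma occupied2_basic (n : nat) (x : {perm 'I_n.+2}) :
  basic_polite x -> starts_leftmost x -> occupied x 2 = ends n.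
Proof.
move=> xP x_left; have := occupiedS x (Ordinal (isT : 1 < n.+2)).
by rewrite second_basic //= occupied1_basic // setUC.
Qed.

Lemma occupied_framed (n : nat) (x : {perm 'I_n.+2}) (t : nat) :
  basic_polite x -> starts_leftmost x -> 1 < t -> framed (occupied x t).
Proof.
move=> xP x_left t1; have sub y : y \in occupied x 2 -> y \in occupied x t.
  by rewrite !mem_occupiedV => /leq_trans; apply.
by rewrite /framed !sub // occupied2_basic // !inE eqxx ?orbT.
Qed.

(** From the third person on, the basic rule too splits a gap at a middle place, so [gap_sum_insert]
    applies even if that gap is not a longest one. *)
Lemma basic_gap (n : nat) (x : {perm 'I_n.+2}) (t : 'I_n.+2) :
  basic_polite x -> starts_leftmost x -> 1 < t ->
  exists g, [/\ gap (occupied x t) g, inside g (x t) &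
    distance (occupied x t) (x t) = uphalf (gap_length g)].
Proof.
move=> xP x_left t1; have fO := occupied_framed xP x_left t1; have [O0 Om] := andP fO.
have xtO : x t \notin occupied x t by rewrite mem_occupied ltnn.
have [g gg xg] := gap_exists O0 Om xtO; exists g; split=> //.
move/forallP: xP => /(_ t); rewrite (ltnW t1) /=.
by rewrite (farthest_gap fO gg xg) => /andP[/eqP].
Qed.

(** The extra term is the second person, who takes the far end at distance [n.+1]; everyone later
    splits a gap. *)
Lemma b_num_basic (n : nat) (x : {perm 'I_n.+2}) (k : nat) :
  basic_polite x -> starts_leftmost x ->
  b_num x k = (k == n.+1) + halving_sum (fun L => uphalf L == k) n.
Proof.
move=> xP x_left; pose w L : nat := uphalf L == k.
pose f t := if t == 1 then (k == n.+1) + gap_sum w (ends n)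
            else gap_sum w (occupied x t).
rewrite -gap_sum_ends -[RHS]/(f 1) /b_num; apply: card_from => //.
  move=> t; rewrite /f; case: (ltngtP 1 t) => // [t1|t1] _; last first.
    have -> : t = Ordinal (isT : 1 < n.+2) by apply: ord_inj.
    rewrite /= occupied2_basic //; congr (nat_of_bool _ + _).
    by rewrite second_basic // occupied1_basic // distance_set1 /=; lia.
  have [g [gg xg dx]] := basic_gap xP x_left t1.
  have -> : (t.+1 == 1 :> nat) = false by lia.
  by rewrite occupiedS (gap_sum_insert w gg xg dx) dx.
by rewrite /f /= occupied_full gap_sum_setT.
Qed.

(** One step to the right moves away from one endpoint and towards the other, so equal distances
    occur only across the middle of a gap of even length. *)
Lemma center_pair (n : nat) (O : {set 'I_n}) (g : 'I_n * 'I_n) (k : nat) (y z : 'I_n) :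
  gap O g -> inside g y -> y \notin O -> z \notin O -> z = y.+1 :> nat ->
  distance O y = k -> distance O z = k ->
  gap_length g = k.*2 /\
  [set v | inside g v & distance O v == k] = [set y; z].
Proof.
case: g => a b gg yg yO zO zy.
have zg : inside (a, b) z.
  case/gapP: (gg) => _ bO _ _; move: yg; rewrite /inside /=.
  have : z != b by apply: contraNneq zO => ->.
  by rewrite -val_eqE /=; lia.
rewrite (distance_gap gg yg) (distance_gap gg zg) => dy dz.
split; first by move: yg zg; rewrite /gap_length /inside; move: dy dz => /=; lia.
apply/setP => v; rewrite !inE -!val_eqE /=; case: (boolP (inside (a, b) v)) => vg.
  by rewrite (distance_gap gg vg); move: yg zg vg dy dz; rewrite /inside /=; lia.
by move: yg zg vg; rewrite /inside /=; lia.
Qed.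

(** The times at which a gap of length [2k] is split correspond bijectively to the pairs counted:
    each such time gives the two middle places of its gap. *)
Lemma d_num_basic (n : nat) (x : {perm 'I_n.+2}) (k : nat) :
  basic_polite x -> starts_leftmost x -> 0 < k -> d_num x k = halving_sum (fun L => L == k.*2) n.
Proof.
move=> xP x_left k0.
pose even_gap (t : 'I_n.+2) := [exists g, [&& gap (occupied x t) g,
  inside g (x t) & gap_length g == k.*2]].
pose A := [set t : 'I_n.+2 | (1 < t) && even_gap t].
pose f t := gap_sum (fun L => L == k.*2) (occupied x t).
have <- : #|A| = halving_sum (fun L => L == k.*2) n.
  rewrite -gap_sum_ends -(occupied2_basic xP x_left) -/(f 2); apply: card_from => //.
    move=> t t1; have [g [gg xg dx]] := basic_gap xP x_left t1.
    rewrite /f occupiedS (gap_sum_insert _ gg xg dx); congr (nat_of_bool _ + _).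
    apply/idP/existsP => [Lg|[h /and3P[gh xh Lh]]]; first by exists g; rewrite gg xg.
    by rewrite (gap_inj gg gh xg xh).
  by rewrite /f occupied_full gap_sum_setT.
pose pair (t : 'I_n.+2) := [set z | [exists g, [&& gap (occupied x t) g,
  inside g (x t), inside g z & distance (occupied x t) z == k]]].
have pairE (t : 'I_n.+2) g : gap (occupied x t) g -> inside g (x t) ->
    pair t = [set z | inside g z & distance (occupied x t) z == k].
  move=> gg xg; apply/setP => z; rewrite !inE; apply/existsP/andP => [|[zg dz]].
    by case=> h /and4P[gh xh zh dz]; rewrite (gap_inj gg gh xg xh).
  by exists g; rewrite gg xg zg.
have pair_mem (t : 'I_n.+2)  : t \in A -> x t \in pair t.
  rewrite inE => /andP[t1 /existsP[g /and3P[gg xg /eqP Lg]]].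
  have [h [gh xh dx]] := basic_gap xP x_left t1.
  by rewrite (pairE t g) // inE xg dx (gap_inj gh gg xh xg) Lg uphalf_double /=.
have pair_empty (t : 'I_n.+2) y : y \in pair t -> y \notin occupied x t.
  rewrite inE => /existsP[g /and4P[gg _ yg _]]; exact: inside_gap_notin yg.
(* At time [t] one place of [pair t] is taken, whereas a pair of a later time is still empty
   then. *)
have pair_inj : {in A &, injective pair}.
  have H (t s : 'I_n.+2) : t < s -> t \in A -> pair t = pair s -> False.
    move=> lt_ts tA E; have := pair_mem t tA; rewrite E => /pair_empty.
    by rewrite mem_occupied lt_ts.
  move=> t s tA sA E; apply: ord_inj; case: (ltngtP t s) => // lt_ts.
    by case: (H t s lt_ts tA E).
  by case: (H s t lt_ts sA (esym E)).
rewrite -(card_in_imset pair_inj) /d_num; apply: eq_card => S; rewrite inE.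
apply/idP/imsetP => [|[t tA ->]]; last first.
  move: (tA); rewrite inE => /andP[t1 /existsP[[a b] /and3P[gg xg /eqP Lg]]].
  have hb := ltn_ord b.
  (* The two middle places are [a + k] and [a + k + 1]. *)
  have ltyn : a + k < n.+2 by move: Lg xg; rewrite /gap_length /inside /=; lia.
  have ltzn : a + k.+1 < n.+2 by move: Lg xg; rewrite /gap_length /inside /=; lia.
  pose y := Ordinal ltyn; pose z := Ordinal ltzn.
  have yg : inside (a, b) y by move: Lg; rewrite /gap_length /inside /=; lia.
  have zg : inside (a, b) z by move: Lg; rewrite /gap_length /inside /=; lia.
  have yO := inside_gap_notin gg yg; have zO := inside_gap_notin gg zg.
  have dy : distance (occupied x t) y = k.
    by rewrite (distance_gap gg yg); move: Lg; rewrite /gap_length /=; lia.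
  have dz : distance (occupied x t) z = k.
    by rewrite (distance_gap gg zg); move: Lg; rewrite /gap_length /=; lia.
  have zy : z = y.+1 :> nat by rewrite /= addnS.
  have [_ yz] := center_pair gg yg yO zO zy dy dz.
  apply/existsP; exists y; apply/existsP; exists z; apply/and3P; split.
  - exact/eqP.
  - by rewrite (pairE t (a, b)) // yz.
  by apply/existsP; exists t; rewrite (ltnW t1) yO zO dy dz !eqxx.
case/existsP=> y /existsP[z /and3P[/eqP zy /eqP-> /existsP[t0 Ct0]]].
pose C (t : 'I_n.+2) := [&& 0 < t, y \notin occupied x t, z \notin occupied x t,
  distance (occupied x t) y == k & distance (occupied x t) z == k].
(* At the last time when both places are empty at distance [k], one of them must be taken. *)
case: (@arg_maxnP _ t0 C val Ct0) => t /and5P[t_gt0 yO zO /eqP dy /eqP dz] tmax.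
(* At time 1 only the left end is taken, and neighbouring places have different distances. *)
have t1 : 1 < t.
  case: (ltngtP 1 t) t_gt0 => // t1 _; move: dy dz.
  by rewrite -t1 occupied1_basic // !distance_set1 /=; lia.
have [O0 Om] := andP (occupied_framed xP x_left t1).
have [g gg yg] := gap_exists O0 Om yO.
have [Lg yz] := center_pair gg yg yO zO zy dy dz.
suff xt : x t \in [set y; z].
  have xg : inside g (x t) by move: xt; rewrite -yz inE => /andP[].
  exists t; last by rewrite (pairE t g) // yz.
  by rewrite inE t1; apply/existsP; exists g; rewrite gg xg Lg /=.
apply: contraT => xtN.
(* A person choosing inside [g] would take a middle place, hence one of the pair. So [g] survives
   with its distances at time [t.+1], against the maximality of [t]. *)
have xg : ~~ inside g (x t).
  apply: contra xtN => xg; rewrite -yz inE xg.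
  have [h [gh xh ->]] := basic_gap xP x_left t1.
  by rewrite (gap_inj gh gg xh xg) Lg uphalf_double eqxx.
have yS : y \notin occupied x t.+1.
  by rewrite occupiedS in_setU1 negb_or yO andbT; apply: contraNneq xtN => <-; rewrite !inE eqxx.
have zS : z \notin occupied x t.+1.
  by rewrite occupiedS in_setU1 negb_or zO andbT; apply: contraNneq xtN => <-; rewrite !inE eqxx orbT.
have ltSt : t.+1 < n.+2.
  rewrite ltn_neqAle ltn_ord andbT; apply: contraNneq yS => ->.
  by rewrite occupied_full inE.
have zg : inside g z.
  by have : z \in [set y; z]; [rewrite !inE eqxx orbT | rewrite -yz inE => /andP[]].
have gS : gap (occupied x t.+1) g by rewrite occupiedS gap_insert_outside.
have := tmax (Ordinal ltSt); rewrite /C /= yS zS.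
rewrite (distance_gap gS yg) (distance_gap gS zg).
rewrite -(distance_gap gg yg) -(distance_gap gg zg) dy dz eqxx /= ltnn.
by move=> /(_ isT).
Qed.

Theorem mainTheorem6 :
  forall n : nat, 2 <= n ->
  forall x : {perm 'I_n}, basic_polite x -> starts_leftmost x ->
    A095240 n =
      2 * \prod_(1 <= j < n) (2 ^ d_num x j * (d_num x j)`! * (b_num x j - d_num x j)`!).
Proof.
move=> [|[|n]] // _ x xP x_left; rewrite card_modified_polite; congr (2 * _).
apply: eq_big_nat => j /andP[j0 ltjn].
rewrite -/(weight (b_num x j) (d_num x j)) b_num_basic // d_num_basic // !gap_sum_ends.
(* Only [j = n.+1] remains, where [b] is 1 because of the second person and no gap contributes;
   since 1! = 0!, the factor is 1 on both sides. *)
case: eqP => // ->.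
have hs0 w : (forall l, l <= n -> w l = 0) -> halving_sum w n = 0.
  move=> w0; case: (posnP n) => [->//|n0].
  by rewrite (@halving_sum_top w n) ?w0 ?n0 ?leqnn // => l /ltnW/w0.
by rewrite !hs0 // => l ln; lia.
Qed.
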